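(* For every integer $n\ge 0$, the Motzkin number $m_n$ is a special value of the associated hybrid Hermite-Laguerre polynomial $\Pi_n^{1}(x,y)$ (the case $\alpha=1$): $$m_n=\Pi_n^{1}(1,1),$$ and the following identity holds (for $t\neq 0$): $$\sum_{n=0}^{\infty}\frac{t^n}{n!}\,\Pi_n^{1}(1,1)=\frac{\exp(t)}{t}\,I_1(2t).$$
   Context: For integers $n\ge 0$, the Motzkin numbers are $$m_n=\sum_{k=0}^{\lfloor n/2\rfloor}\frac{n!}{k!\,(k+1)!\,(n-2k)!}.$$ The associated hybrid Hermite-Laguerre polynomials are $$\Pi_n^{\alpha}(x,y)=n!\sum_{k=0}^{\lfloor n/2\rfloor}\frac{x^k y^{n-2k}}{(n-2k)!\,k!\,\Gamma(k+\alpha+1)}.$$ (Equivalently, $\Pi_n^{\alpha}(x,y)=H_n(y,\widehat{D}_{x,\alpha}^{-1})\mathbf 1$, where $H_n(x,y)=n!\sum_{k=0}^{\lfloor n/2\rfloor}\frac{x^{n-2k}y^k}{k!(n-2k)!}$ and the operator $\widehat{D}_{x,\alpha}^{-1}$ is specified by $\widehat{D}_{x,\alpha}^{-n}\mathbf 1=\frac{x^n}{\Gamma(n+\alpha+1)}$.) For integers $n\ge 0$, $I_n$ denotes the modified Bessel function of the first kind, $$I_n(x)=\sum_{r=0}^{\infty}\frac{(x/2)^{n+2r}}{r!\,(n+r)!}.$$ *)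

(* Defs.v *)
(* The arguments [alpha], [x], [y], [t] are complex, so the real case is included. *)
From Stdlib Require Import Reals Factorial.
From Coquelicot Require Import Coquelicot.
Open Scope C_scope.

Definition factC (n : nat) : C := RtoC (INR (fact n)).

Definition Cexp (z : C) : C :=
  RtoC (exp (Re z)) * (cos (Im z), sin (Im z)).

(* For Coquelicot, a complex sequence converges iff its real and imaginary
   parts do; when the series diverges the value is unspecified. *)
Definition CSeries (a : nat -> C) : C :=
  (Series (fun n => Re (a n)), Series (fun n => Im (a n))).

(* Euler's integral of [u ^ (s - 1) * exp (- u)] over [0 < u], meaningful when
   [0 < Re s]. *)
Definition Gamma_integral (s : C) : C :=
  RInt_gen (V := C_R_CompleteNormedModule)
    (fun u : R => Cexp ((s - 1) * RtoC (ln u)) * RtoC (exp (- u)))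
    (at_right 0) (Rbar_locally p_infty).

Fixpoint Gamma_shift (j : nat) (s : C) : C :=
  match j with
  | O => Gamma_integral s
  | S j' => Gamma_shift j' (s + 1) / s
  end.

(* Continued by [Gamma s = Gamma (s + 1) / s] from the half-plane [0 < Re s],
   where the number of shifts is 0, to the whole plane.  At the poles
   [s = 0, -1, -2, ...], [Gamma s] is 0 because [/ 0 = 0] in [C]; hence
   [/ Gamma s] is everywhere the entire reciprocal Gamma function. *)
Definition Gamma (s : C) : C :=
  Gamma_shift (Z.to_nat (up (- Re s))) s.

Definition motzkin (n : nat) : R :=
  sum_n (fun k : nat =>
    (INR (fact n)
     / (INR (fact k) * INR (fact (k + 1)) * INR (fact (n - 2 * k))))%R)
    (n / 2)%nat.

Definition hybridHL (n : nat) (alpha x y : C) : C :=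
  factC n *
  sum_n (fun k : nat =>
    x ^ k * y ^ (n - 2 * k)
    / (factC (n - 2 * k) * factC k * Gamma (RtoC (INR k) + alpha + 1)))
    (n / 2)%nat.

Definition BesselI (n : nat) (z : C) : C :=
  CSeries (fun r : nat =>
    (z / 2) ^ (n + 2 * r) / (factC r * factC (n + r))).

(* Main.v *)
Require Import Defs.
From Stdlib Require Import Reals Factorial Lia Lra.
From Coquelicot Require Import Coquelicot.

(** Since [Gamma (k + 2) = (k + 1)!], the number [hybridHL n 1 1 1] is term by
    term the defining sum of [motzkin n].

    For the generating function, cancel the [n!] and split
    [t ^ n = t ^ (2 k) * t ^ (n - 2 k)]:
    [t ^ n / n! * hybridHL n 1 1 1] becomes the sum over [2 k <= n] of
    [t ^ (2 k) / (k! (k + 1)!)] times [t ^ (n - 2 k) / (n - 2 k)!].  This is the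
    [n]-th coefficient of a Cauchy product: one factor is the exponential series
    of [t], the other is the series of [I_1 (2 t) / t] spread over the even
    indices, with zeros at the odd ones ([exp_term_mul_hybridHL]).  Both series
    converge absolutely, so the product converges to [exp t * I_1 (2 t) / t]
    ([is_series_Cmult]).

    Two classical facts carry the rest.  The complex exponential, given as
    [exp x * (cos y + i sin y)], is the sum of its power series
    ([is_series_Cexp]); and Euler's integral takes the value [n!] at [n + 1]
    ([Gamma_succ_nat]), because [u ^ n * exp (- u)] has an explicit primitive. *)

Open Scope C_scope.

(** * Complex series and their Cauchy product *)

Lemma sum_n_C (a : nat -> C) (n : nat) :
  sum_n a n = (sum_n (fun k => Re (a k)) n, sum_n (fun k => Im (a k)) n).
Proof.
  induction n as [|n IH].
  - rewrite !sum_O. apply surjective_pairing.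
  - now rewrite !sum_Sn, IH.
Qed.

(** The uniform structure of [C] is that of the product [R * R], whose balls are
    products of balls; this is what lets theorems on real series be used
    componentwise. *)
Lemma is_series_C_components (a : nat -> C) (l : C) :
  is_series (V := C_NormedModule) a l <->
  is_series (fun n => Re (a n)) (Re l) /\ is_series (fun n => Im (a n)) (Im l).
Proof.
  split.
  - intros H; split; apply filterlim_locally; intros eps;
      generalize (proj1 (filterlim_locally (U := C_UniformSpace) _ _) H eps);
      apply filter_imp; intros n Hn; rewrite sum_n_C in Hn; apply Hn.
  - intros [H1 H2].
    apply (filterlim_locally (U := C_UniformSpace)). intros eps.
    generalize (filter_and _ _ (proj1 (filterlim_locally _ _) H1 eps)
                               (proj1 (filterlim_locally _ _) H2 eps)).
    apply filter_imp. intros n Hn. rewrite sum_n_C. exact Hn.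
Qed.

Lemma CSeries_correct (a : nat -> C) (l : C) :
  is_series (V := C_NormedModule) a l -> CSeries a = l.
Proof.
  intros H. apply is_series_C_components in H as [H1 H2].
  unfold CSeries. rewrite (is_series_unique _ _ H1), (is_series_unique _ _ H2).
  symmetry; apply surjective_pairing.
Qed.

Lemma ex_series_Rabs_Re (a : nat -> C) :
  ex_series (fun n => Cmod (a n)) -> ex_series (fun n => Rabs (Re (a n))).
Proof.
  apply @ex_series_le. intros n. change norm with Rabs. rewrite Rabs_Rabsolu.
  apply re_le_Cmod.
Qed.

Lemma ex_series_Rabs_Im (a : nat -> C) :
  ex_series (fun n => Cmod (a n)) -> ex_series (fun n => Rabs (Im (a n))).
Proof.
  apply @ex_series_le. intros n. change norm with Rabs. rewrite Rabs_Rabsolu.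
  eapply Rle_trans; [apply Rmax_r | apply (Rmax_Cmod (a n))].
Qed.

(** Each component of the complex product is a combination of two real Cauchy
    products, and absolute convergence in [C] passes to the components, so the
    real theorem applies four times. *)
Lemma is_series_Cmult (a b : nat -> C) (la lb : C) :
  is_series (V := C_NormedModule) a la ->
  is_series (V := C_NormedModule) b lb ->
  ex_series (fun n => Cmod (a n)) ->
  ex_series (fun n => Cmod (b n)) ->
  is_series (V := C_NormedModule)
    (fun n => sum_n (fun k => a k * b (n - k)%nat) n) (la * lb).
Proof.
  rewrite !is_series_C_components. intros [Ha1 Ha2] [Hb1 Hb2] Ma Mb.
  pose proof (ex_series_Rabs_Re _ Ma) as Na1.
  pose proof (ex_series_Rabs_Im _ Ma) as Na2.
  pose proof (ex_series_Rabs_Re _ Mb) as Nb1.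
  pose proof (ex_series_Rabs_Im _ Mb) as Nb2.
  pose proof (is_series_mult _ _ _ _ Ha1 Hb1 Na1 Nb1) as P11.
  pose proof (is_series_mult _ _ _ _ Ha1 Hb2 Na1 Nb2) as P12.
  pose proof (is_series_mult _ _ _ _ Ha2 Hb1 Na2 Nb1) as P21.
  pose proof (is_series_mult _ _ _ _ Ha2 Hb2 Na2 Nb2) as P22.
  split.
  - eapply is_series_ext; [|exact (is_series_minus _ _ _ _ P11 P22)].
    intros n. rewrite sum_n_C. simpl. rewrite sum_n_Reals.
    symmetry. apply minus_sum.
  - eapply is_series_ext; [|exact (is_series_plus _ _ _ _ P12 P21)].
    intros n. rewrite sum_n_C. simpl. rewrite sum_n_Reals.
    symmetry. apply sum_plus.
Qed.

Lemma ex_series_Cmod (a : nat -> C) :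
  ex_series (fun n => Cmod (a n)) -> ex_series (V := C_NormedModule) a.
Proof.
  apply (ex_series_le (V := C_CompleteNormedModule)).
  intros n. apply Rle_refl.
Qed.

(** * Series supported on the even indices *)

Lemma sum_n_even {G : AbelianMonoid} (f : nat -> G) (n : nat) :
  sum_n (fun k => if Nat.even k then f (k / 2)%nat else zero) n
  = sum_n f (n / 2).
Proof.
  induction n as [|n IH]; [now rewrite !sum_O|].
  rewrite sum_Sn, IH.
  destruct (Nat.Even_or_Odd n) as [[m ->]|[m ->]].
  - replace (Nat.even (S (2 * m))) with false
      by (rewrite Nat.even_succ, Nat.odd_mul; easy).
    rewrite plus_zero_r.
    replace (S (2 * m)) with (1 + m * 2)%nat by lia.
    rewrite Nat.div_add, (Nat.mul_comm 2), Nat.div_mul by lia. easy.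
  - replace (S (2 * m + 1)) with ((S m) * 2)%nat by lia.
    replace (2 * m + 1)%nat with (1 + m * 2)%nat by lia.
    rewrite Nat.even_mul, Bool.orb_true_r, Nat.div_add, Nat.div_mul by lia.
    simpl Nat.div. rewrite sum_Sn. easy.
Qed.

(** The partial sums are those of [b], each repeated twice. *)
Lemma is_series_even {K : AbsRing} {V : NormedModule K}
    (b : nat -> V) (l : V) :
  is_series b l ->
  is_series (fun n => if Nat.even n then b (n / 2)%nat else zero) l.
Proof.
  intros H.
  apply filterlim_ext with (fun n => sum_n b (n / 2)).
  { intros n. symmetry. apply sum_n_even. }
  apply (filterlim_comp _ _ _ (fun n => n / 2)%nat (sum_n b) _ eventually);
    [|exact H].
  intros P [N HN]. exists (2 * N)%nat. intros n Hn. apply HN.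
  apply Nat.div_le_lower_bound; lia.
Qed.

(** * The exponential series in the complex plane *)

Definition exp_term (z : C) (n : nat) : C := z ^ n / factC n.

Lemma factC_neq_0 (n : nat) : factC n <> 0.
Proof. intros H. apply RtoC_inj in H. revert H. apply INR_fact_neq_0. Qed.

Lemma factC_S (n : nat) : factC (S n) = RtoC (INR (S n)) * factC n.
Proof.
  unfold factC. rewrite <- RtoC_mult, <- mult_INR. now rewrite fact_simpl.
Qed.

Lemma RtoC_INR_S_neq_0 (n : nat) : RtoC (INR (S n)) <> 0.
Proof. intros H. apply RtoC_inj in H. revert H. now apply not_0_INR. Qed.

Lemma exp_term_S (z : C) (n : nat) :
  RtoC (INR (S n)) * exp_term z (S n) = z * exp_term z n.
Proof.
  unfold exp_term. rewrite factC_S, Cpow_S.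
  field. split; [apply factC_neq_0 | apply RtoC_INR_S_neq_0].
Qed.

Lemma Cmod_exp_term (z : C) (n : nat) :
  Cmod (exp_term z n) = (/ INR (fact n) * Cmod z ^ n)%R.
Proof.
  unfold exp_term. rewrite Cmod_div by apply factC_neq_0.
  rewrite Cmod_pow. unfold factC. rewrite Cmod_R, Rabs_pos_eq by apply pos_INR.
  unfold Rdiv. ring.
Qed.

Lemma ex_series_Cmod_exp_term (z : C) :
  ex_series (fun n => Cmod (exp_term z n)).
Proof.
  exists (exp (Cmod z)).
  eapply is_series_ext; [|exact (proj1 (is_pseries_R _ _ _) (is_exp_Reals _))].
  intros n. symmetry. apply Cmod_exp_term.
Qed.

Lemma sum_n_first {G : AbelianMonoid} (f : nat -> G) (n : nat) :
  sum_n f (S n) = plus (f O) (sum_n (fun k => f (S k)) n).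
Proof.
  unfold sum_n. rewrite sum_Sn_m by lia. now rewrite sum_n_m_S.
Qed.

(* Algebraic goals produced by [sum_n] or [is_series] live in the carrier of a
   structure, where [ring] and [field] do not see the concrete field. *)
Ltac R_eq := match goal with |- ?a = ?b => change (@eq R a b) end.
Ltac C_eq := match goal with |- ?a = ?b => change (@eq C a b) end.

(** The binomial theorem in divided form.  Both sides [T n] satisfy
    [(n + 1) * T (n + 1) = (x + y) * T n]: on the left, write
    [n + 1 = k + (n + 1 - k)] in the [k]-th summand and lower the index of the
    first or of the second factor. *)
Lemma exp_term_add (x y : C) (n : nat) :
  sum_n (fun k => exp_term x k * exp_term y (n - k)) n = exp_term (x + y) n.
Proof.
  induction n as [|n IH].
  - rewrite sum_O. unfold exp_term. change (factC 0) with (RtoC 1).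
    simpl Nat.sub. change (factC 0) with (RtoC 1). simpl Cpow.
    C_eq. field.
  - C_eq. set (T := sum_n _ (S n) : C).
    enough (H : RtoC (INR (S n)) * T
                = RtoC (INR (S n)) * exp_term (x + y) (S n)).
    { replace T with (/ RtoC (INR (S n)) * (RtoC (INR (S n)) * T))
        by (field; apply RtoC_INR_S_neq_0).
      rewrite H. field. apply RtoC_INR_S_neq_0. }
    rewrite exp_term_S, <- IH, Cmult_plus_distr_r. unfold T.
    rewrite <- !(sum_n_mult_l (K := C_Ring)).
    transitivity (sum_n (fun k =>
      (RtoC (INR k) * exp_term x k) * exp_term y (S n - k)
      + exp_term x k * (RtoC (INR (S n - k)) * exp_term y (S n - k))) (S n)).
    { apply sum_n_ext_loc. intros k Hk. change (@mult C_Ring) with Cmult.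
      rewrite minus_INR, RtoC_minus by exact Hk. C_eq. ring. }
    rewrite (sum_n_plus (G := C_AbelianMonoid)).
    change plus with Cplus. f_equal.
    + rewrite sum_n_first. cbv beta. change (INR 0) with 0%R.
      change plus with Cplus. rewrite !Cmult_0_l, Cplus_0_l.
      apply sum_n_ext. intros k. rewrite exp_term_S.
      change (@mult C_Ring) with Cmult. simpl Nat.sub. C_eq. ring.
    + rewrite sum_Sn, Nat.sub_diag. cbv beta. change (INR 0) with 0%R.
      change plus with Cplus. rewrite Cmult_0_l, Cmult_0_r, Cplus_0_r.
      apply sum_n_ext_loc. intros k Hk. rewrite Nat.sub_succ_l by exact Hk.
      rewrite exp_term_S. change (@mult C_Ring) with Cmult. C_eq. ring.
Qed.

Lemma is_series_zero {K : AbsRing} {V : NormedModule K} :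
  is_series (fun _ : nat => zero : V) zero.
Proof.
  apply filterlim_ext with (fun _ : nat => zero : V); [|apply filterlim_const].
  intros n. symmetry. induction n as [|n IH]; [apply sum_O|].
  now rewrite sum_Sn, IH, plus_zero_l.
Qed.

Lemma Ci_pow_even (n : nat) : Ci ^ (2 * n) = RtoC ((-1) ^ n).
Proof.
  rewrite Cpow_mult_r, RtoC_pow. f_equal.
  unfold Ci. apply injective_projections; simpl; ring.
Qed.

Lemma Ci_pow_odd (n : nat) : Ci ^ (2 * n + 1) = (0, (-1) ^ n)%R.
Proof.
  rewrite Nat.add_1_r, Cpow_S, Ci_pow_even.
  apply injective_projections; simpl; ring.
Qed.

Lemma exp_term_Ci (y : R) (n : nat) :
  exp_term (Ci * RtoC y) n = (Re (Ci ^ n) / INR (fact n) * y ^ n,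
                              Im (Ci ^ n) / INR (fact n) * y ^ n)%R.
Proof.
  unfold exp_term, factC. unfold Cdiv.
  rewrite Cpow_mult_l, <- RtoC_pow, <- RtoC_inv by apply INR_fact_neq_0.
  destruct (Ci ^ n) as [p q].
  apply injective_projections; simpl; unfold Rdiv; ring.
Qed.

(** Since [i ^ (2 k) = (-1) ^ k], the even terms give the series of the cosine
    and the odd terms that of the sine. *)
Lemma is_series_exp_imaginary (y : R) :
  is_series (V := C_NormedModule) (exp_term (Ci * RtoC y)) (cos y, sin y).
Proof.
  apply is_series_C_components. unfold cos, sin.
  destruct (exist_cos (Rsqr y)) as [c Hc], (exist_sin (Rsqr y)) as [s Hs].
  apply is_series_Reals in Hc, Hs. rewrite Rsqr_pow2 in Hc, Hs.
  split.
  - apply (is_series_ext (fun n => Re (Ci ^ n) / INR (fact n) * y ^ n)%R).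
    { intros n. now rewrite exp_term_Ci. }
    change (Re (c, (y * s)%R)) with c.
    apply is_pseries_R. replace c with (c + y * 0)%R by ring.
    apply is_pseries_odd_even; apply is_pseries_R.
    + eapply is_series_ext; [|exact Hc].
      intros n. now rewrite Ci_pow_even.
    + eapply is_series_ext; [|apply (is_series_zero (V := R_NormedModule))].
      intros n. rewrite Ci_pow_odd. change (@zero R_NormedModule) with 0%R.
      unfold Rdiv. simpl Re. R_eq. ring.
  - apply (is_series_ext (fun n => Im (Ci ^ n) / INR (fact n) * y ^ n)%R).
    { intros n. now rewrite exp_term_Ci. }
    change (Im (c, (y * s)%R)) with (y * s)%R.
    apply is_pseries_R. replace (y * s)%R with (0 + y * s)%R by ring.
    apply is_pseries_odd_even; apply is_pseries_R.
    + eapply is_series_ext; [|apply (is_series_zero (V := R_NormedModule))].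
      intros n. rewrite Ci_pow_even. change (@zero R_NormedModule) with 0%R.
      unfold Rdiv. simpl Im. R_eq. ring.
    + eapply is_series_ext; [|exact Hs].
      intros n. now rewrite Ci_pow_odd.
Qed.

Lemma is_series_exp_real (x : R) :
  is_series (V := C_NormedModule) (exp_term (RtoC x)) (RtoC (exp x)).
Proof.
  assert (H : forall n, exp_term (RtoC x) n = RtoC (/ INR (fact n) * x ^ n)).
  { intros n. unfold exp_term, factC.
    rewrite <- RtoC_pow, <- RtoC_div by apply INR_fact_neq_0.
    f_equal. unfold Rdiv. ring. }
  apply is_series_C_components. split.
  - eapply is_series_ext; [|exact (proj1 (is_pseries_R _ _ _) (is_exp_Reals _))].
    intros n. now rewrite H.
  - eapply is_series_ext; [|apply (is_series_zero (V := R_NormedModule))].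
    intros n. now rewrite H.
Qed.

(** The series at [x + i y] is the Cauchy product of the series at [x] and at
    [i y], by the binomial theorem. *)
Lemma is_series_Cexp (z : C) :
  is_series (V := C_NormedModule) (exp_term z) (Cexp z).
Proof.
  eapply is_series_ext; [|apply is_series_Cmult;
    [apply (is_series_exp_real (Re z)) | apply (is_series_exp_imaginary (Im z))
    | apply ex_series_Cmod_exp_term | apply ex_series_Cmod_exp_term]].
  intros n. simpl. rewrite exp_term_add. f_equal.
  destruct z. apply injective_projections; simpl; ring.
Qed.

(** * The Gamma function at positive integers *)

(** The Taylor bound [u ^ (n + 1) / (n + 1)! <= exp u] for [0 <= u] gives
    [u ^ n * exp (- u) <= (n + 1)! / u]. *)
Lemma is_lim_pow_mul_exp_opp (n : nat) :
  is_lim (fun u => u ^ n * exp (- u))%R p_infty 0%R.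
Proof.
  apply (is_lim_le_le_loc (fun _ => 0%R) (fun u => INR (fact (S n)) * / u)%R).
  - exists 0%R. intros u Hu. split.
    + apply Rmult_le_pos; [apply pow_le; lra | left; apply exp_pos].
    + assert (H : (u ^ S n / INR (fact (S n)) <= exp u)%R).
      { eapply Rle_trans; [|apply (exp_ge_taylor u (S n)); lra].
        rewrite tech5.
        assert (0 <= sum_f_R0 (fun k => u ^ k / INR (fact k)) n)%R; [|lra].
        apply cond_pos_sum. intros k. apply Rdiv_le_0_compat.
        - apply pow_le; lra.
        - apply INR_fact_lt_0. }
      pose proof (INR_fact_lt_0 (S n)) as Hf.
      apply (Rmult_le_reg_r (u * exp u));
        [apply Rmult_lt_0_compat; [lra|apply exp_pos]|].
      rewrite exp_Ropp. apply (Rmult_le_compat_r (INR (fact (S n)))) in H; [|lra].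
      unfold Rdiv in H. rewrite Rmult_assoc, Rinv_l, Rmult_1_r in H by lra.
      simpl in H. pose proof (exp_pos u).
      replace (u ^ n * / exp u * (u * exp u))%R with (u * u ^ n)%R by (field; lra).
      replace (INR (fact (S n)) * / u * (u * exp u))%R
        with (exp u * INR (fact (S n)))%R by (field; lra).
      exact H.
  - apply is_lim_const.
  - replace (Finite 0) with (Rbar_mult (INR (fact (S n))) (Rbar_inv p_infty)).
    2:{ simpl. now rewrite Rmult_0_r. }
    apply is_lim_scal_l, is_lim_inv; [apply is_lim_id|easy].
Qed.

(** Integration by parts, at the level of primitives:
    [F (n + 1) u = (n + 1) * F n u - u ^ (n + 1) * exp (- u)], starting from
    [F 0 u = - exp (- u)].  The integral over the half-line is then
    [0 - F n 0 = n!]. *)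
Lemma antiderivative_pow_mul_exp_opp (n : nat) :
  exists F : R -> R,
    F 0%R = (- INR (fact n))%R /\
    (forall u : R, is_derive F u (u ^ n * exp (- u))%R) /\
    is_lim F p_infty 0%R.
Proof.
  induction n as [|n (F & F0 & dF & Flim)].
  - exists (fun u => - exp (- u))%R. split; [|split].
    + rewrite Ropp_0, exp_0. reflexivity.
    + intros u. auto_derive; [easy|]. simpl. ring.
    + replace (Finite 0) with (Rbar_opp 0) by (simpl; f_equal; ring).
      apply is_lim_opp.
      eapply is_lim_ext; [|apply (is_lim_pow_mul_exp_opp 0)].
      intros u; simpl; ring.
  - exists (fun u => INR (S n) * F u - u ^ S n * exp (- u))%R.
    split; [|split].
    + rewrite F0, fact_simpl, mult_INR. simpl. ring.
    + intros u.
      auto_derive; [repeat split; eexists; apply dF|].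
      assert (D : Derive (fun v : R => F v) u = (u ^ n * exp (- u))%R)
        by exact (is_derive_unique F u _ (dF u)).
      rewrite D. cbn [Init.Nat.pred pow]. ring.
    + replace (Finite 0) with (Finite (INR (S n) * 0 - 0)) by (f_equal; ring).
      apply is_lim_minus'; [|apply is_lim_pow_mul_exp_opp].
      apply (is_lim_scal_l _ (INR (S n)) p_infty 0%R), Flim.
Qed.

Lemma Gamma_integrand_nat (n : nat) (u : R) : (0 < u)%R ->
  Cexp ((RtoC (INR n) + 1 - 1) * RtoC (ln u)) * RtoC (exp (- u))
  = RtoC (u ^ n * exp (- u)).
Proof.
  intros Hu. rewrite RtoC_mult. f_equal.
  rewrite <- (Rpower_pow n u Hu). unfold Cexp, Rpower. simpl.
  replace ((INR n + 1 + - (1)) * ln u - (0 + 0 + - 0) * 0)%R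
    with (INR n * ln u)%R by ring.
  replace ((INR n + 1 + - (1)) * 0 + (0 + 0 + - 0) * ln u)%R with 0%R by ring.
  rewrite cos_0, sin_0. apply Cmult_1_r.
Qed.

Lemma Gamma_succ_nat (n : nat) : Gamma (RtoC (INR n) + 1) = factC n.
Proof.
  unfold Gamma.
  (* The argument has positive real part, so the continuation makes no shift. *)
  replace (Z.to_nat _) with O.
  2:{ simpl Re. pose proof (archimed (- (INR n + 1))) as [_ H].
      pose proof (pos_INR n).
      assert (up (- (INR n + 1)) <= 0)%Z by (apply le_IZR; lra).
      lia. }
  simpl. unfold Gamma_integral.
  apply (is_RInt_gen_unique (V := C_R_CompleteNormedModule)).
  destruct (antiderivative_pow_mul_exp_opp n) as (F & F0 & dF & Flim).
  (* On an interval [a, b] in the positive half-line the integral exists and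
     is [F b - F a], with imaginary part 0; then let [a] and [b] go to the ends. *)
  apply (filterlimi_lim_ext_loc (U := C_UniformSpace)
    (fun ab => (F (snd ab) - F (fst ab), 0)%R)).
  - apply (Filter_prod _ _ _ (fun a => 0 < a)%R (fun b => 0 < b)%R).
    + exists (mkposreal 1 Rlt_0_1). intros a _ Ha. exact Ha.
    + exists 0%R. intros b Hb. exact Hb.
    + intros a b Ha Hb. simpl fst. simpl snd.
      apply (is_RInt_ext (V := C_R_NormedModule)
        (fun u => RtoC (u ^ n * exp (- u)))).
      { intros u [Hu _]. symmetry. apply Gamma_integrand_nat.
        eapply Rlt_trans; [|exact Hu]. now apply Rmin_glb_lt. }
      apply (is_RInt_fct_extend_pair (U := R_NormedModule) (V := R_NormedModule));
        simpl.
      * apply (is_RInt_derive (V := R_CompleteNormedModule) F).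
        -- intros u _. apply dF.
        -- intros u _. apply (ex_derive_continuous (V := R_NormedModule)).
           auto_derive. easy.
      * pose proof (is_RInt_const (V := R_NormedModule) a b 0%R) as H.
        change (scal (b - a)%R 0%R) with ((b - a) * 0)%R in H.
        rewrite Rmult_0_r in H. exact H.
  - assert (Ha : filterlim F (at_right 0) (locally (F 0%R))).
    { eapply filterlim_filter_le_1; [apply filter_le_within|].
      apply (ex_derive_continuous (V := R_NormedModule)). eexists. apply dF. }
    apply (filterlim_locally (U := C_UniformSpace)). intros eps.
    assert (H2 : (0 < eps / 2)%R) by (destruct eps; simpl; lra).
    set (e2 := mkposreal _ H2).
    apply (Filter_prod _ _ _ (fun a => ball (F 0%R) e2 (F a))
                             (fun b => ball 0%R e2 (F b))).
    + exact (proj1 (filterlim_locally _ _) Ha e2).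
    + exact (proj1 (filterlim_locally _ _) Flim e2).
    + intros a b Ba Bb. rewrite F0 in Ba. split; simpl; [|apply ball_center].
      apply Rabs_lt_between. apply Rabs_lt_between in Ba, Bb.
      unfold minus, plus, opp in *; simpl in *. lra.
Qed.

(** * The Bessel series *)

(** The terms of the series of [I_1 (2 t) / t], see [is_series_bessel_term]. *)
Definition bessel_term (t : C) (k : nat) : C :=
  t ^ (2 * k) / (factC k * factC (k + 1)).

Lemma Cmod_factC (n : nat) : Cmod (factC n) = INR (fact n).
Proof. unfold factC. rewrite Cmod_R, Rabs_pos_eq; [easy|apply pos_INR]. Qed.

(** Domination by the exponential series of [t ^ 2], as [1 <= (k + 1)!]. *)
Lemma ex_series_Cmod_bessel_term (t : C) :
  ex_series (fun k => Cmod (bessel_term t k)).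
Proof.
  eapply (ex_series_le (V := R_CompleteNormedModule));
    [|apply (ex_series_Cmod_exp_term (t ^ 2))].
  intros k. change norm with Rabs. rewrite (Rabs_pos_eq _ (Cmod_ge_0 _)).
  cbv beta.
  replace (bessel_term t k) with (exp_term (t ^ 2) k * / factC (k + 1)).
  2:{ unfold bessel_term, exp_term. rewrite Cpow_mult_r. field.
      split; apply factC_neq_0. }
  rewrite Cmod_mult, Cmod_inv, Cmod_factC by apply factC_neq_0.
  rewrite <- (Rmult_1_r (Cmod _)), Rmult_assoc.
  apply Rmult_le_compat_l; [apply Cmod_ge_0|]. rewrite Rmult_1_l.
  rewrite <- Rinv_1. apply Rinv_le_contravar; [lra|].
  apply (le_INR 1), lt_O_fact.
Qed.

Lemma is_series_bessel_term (t : C) : t <> 0 ->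
  is_series (V := C_NormedModule) (bessel_term t) (BesselI 1 (2 * t) / t).
Proof.
  intros Ht.
  assert (exists l : C, is_series (V := C_NormedModule) (bessel_term t) l)
    as [l Hl] by exact (ex_series_Cmod _ (ex_series_Cmod_bessel_term t)).
  replace (BesselI 1 (2 * t) / t) with l; [exact Hl|].
  unfold BesselI. rewrite (CSeries_correct _ (t * l)).
  { field. exact Ht. }
  eapply is_series_ext;
    [|apply (is_series_scal_l (V := C_NormedModule) t), Hl].
  intros r. unfold bessel_term.
  change (scal (V := C_NormedModule)) with Cmult.
  replace (2 * t / 2) with t by (field; exact (RtoC_INR_S_neq_0 1)).
  rewrite Cpow_add_r, Cpow_1_r, (Nat.add_comm 1 r). C_eq. field.
  split; apply factC_neq_0.
Qed.

(** * Motzkin numbers and their generating function *)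

Lemma hybridHL_one (n : nat) :
  hybridHL n 1 1 1
  = factC n * sum_n (fun k => / (factC (n - 2 * k) * factC k * factC (k + 1)))
                    (n / 2).
Proof.
  unfold hybridHL. f_equal. apply sum_n_ext. intros k.
  replace (RtoC (INR k) + 1 + 1) with (RtoC (INR (k + 1)) + 1)
    by (rewrite plus_INR, RtoC_plus; reflexivity).
  rewrite Gamma_succ_nat, !Cpow_1_l. C_eq. field.
  repeat split; apply factC_neq_0.
Qed.

Lemma RtoC_sum_n (u : nat -> R) (n : nat) :
  RtoC (sum_n u n) = sum_n (fun k => RtoC (u k)) n.
Proof.
  induction n as [|n IH]; [now rewrite !sum_O|].
  rewrite !sum_Sn, <- IH. apply RtoC_plus.
Qed.

Lemma motzkin_hybridHL (n : nat) : RtoC (motzkin n) = hybridHL n 1 1 1.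
Proof.
  rewrite hybridHL_one. unfold motzkin.
  rewrite RtoC_sum_n, <- (sum_n_mult_l (K := C_Ring)).
  apply sum_n_ext. intros k. change (@mult C_Ring) with Cmult.
  rewrite (Rmult_comm (_ * _)), <- Rmult_assoc.
  rewrite RtoC_div, !RtoC_mult; [easy|].
  repeat apply Rmult_integral_contrapositive_currified; apply INR_fact_neq_0.
Qed.

(** The left side is a sum over [k <= n / 2]; inserting zeros at the odd indices
    turns it into a Cauchy product coefficient, a sum over [k <= n]. *)
Lemma exp_term_mul_hybridHL (t : C) (n : nat) :
  exp_term t n * hybridHL n 1 1 1
  = sum_n (fun k => (if Nat.even k then bessel_term t (k / 2) else 0)
                    * exp_term t (n - k)) n.
Proof.
  set (f := fun j => bessel_term t j * exp_term t (n - 2 * j)).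
  transitivity (sum_n f (n / 2)).
  - rewrite hybridHL_one, Cmult_assoc, <- (sum_n_mult_l (K := C_Ring)).
    apply sum_n_ext_loc. intros k Hk. change (@mult C_Ring) with Cmult.
    unfold f, exp_term, bessel_term.
    assert (Hkn : (2 * k <= n)%nat).
    { pose proof (Nat.Div0.mul_div_le n 2). lia. }
    replace (t ^ n) with (t ^ (2 * k) * t ^ (n - 2 * k))
      by (rewrite <- Cpow_add_r; f_equal; lia).
    C_eq. field. repeat split; apply factC_neq_0.
  - rewrite <- sum_n_even. apply sum_n_ext. intros k. unfold f.
    destruct (Nat.even k) eqn:Hk; [|symmetry; apply Cmult_0_l].
    apply Nat.even_spec in Hk as [m ->].
    rewrite (Nat.mul_comm 2 m), Nat.div_mul, (Nat.mul_comm m 2) by lia.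
    reflexivity.
Qed.

Theorem corollary15 :
  (forall n : nat, RtoC (motzkin n) = hybridHL n 1 1 1) /\
  (forall t : C, t <> 0 ->
    is_series (V := C_NormedModule)
      (fun n : nat => t ^ n / factC n * hybridHL n 1 1 1)
      (Cexp t / t * BesselI 1 (2 * t))).
Proof.
  split; [exact motzkin_hybridHL|]. intros t Ht.
  replace (Cexp t / t * BesselI 1 (2 * t))
    with (BesselI 1 (2 * t) / t * Cexp t) by (field; exact Ht).
  eapply is_series_ext; [intros n; symmetry; apply exp_term_mul_hybridHL|].
  apply is_series_Cmult.
  - apply (is_series_even (V := C_NormedModule)), is_series_bessel_term, Ht.
  - apply is_series_Cexp.
  - destruct (ex_series_Cmod_bessel_term t) as [l Hl]. exists l.
    eapply is_series_ext; [|apply (is_series_even _ _ Hl)].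
    intros n. simpl. destruct (Nat.even n); [easy|]. now rewrite Cmod_0.
  - apply ex_series_Cmod_exp_term.
Qed.
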